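(* Let $X\neq\{0\}$ be a real normed barrelled space and let $T:X\rightrightarrows X^*$ be a (non-empty) monotone operator. If $T$ is demiclosed, then $T$ is strongly$\times$weakly-star upper semicontinuous at every $x\in\operatorname{core}D(T)$; that is, for every $x\in\operatorname{core}D(T)$ and every weak-star open set $V\supset T(x)$ there is a norm neighborhood $U$ of $x$ such that $T(U):=\bigcup_{u\in U}T(u)\subset V$.
   Context: $X^*$ is the topological dual of $X$, $\langle x,x^*\rangle:=x^*(x)$. A multifunction $T:X\rightrightarrows X^*$ is identified with its graph $\{(x,x^* )\mid x^*\in T(x)\}$; $D(T)=\{x\mid T(x)\neq\emptyset\}$. $T$ is monotone if $\langle x_1-x_2,x_1^*-x_2^*\rangle\ge0$ for all $(x_1,x_1^* ),(x_2,x_2^* )\in T$. $T$ is demiclosed if whenever $(x_i,x_i^* )_i$ is a net in the graph of $T$ with $x_i\to x_0$ in norm, $x_i^*\to x_0^*$ weakly-star and $(x_i^* )_i$ norm bounded, one has $(x_0,x_0^* )\in T$. $\operatorname{core}S$ is the algebraic interior: the set of $s\in S$ such that for every $v\in X$ there is $\rho>0$ with $s+\lambda v\in S$ for all $\lambda\in[0,\rho]$. *)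

(* Defs.v *)
From HB Require Import structures.
From mathcomp Require Import all_boot all_order all_algebra.
From mathcomp Require Import all_classical all_reals all_analysis.

Set Implicit Arguments.
Unset Strict Implicit.
Unset Printing Implicit Defensive.

Import Order.TTheory GRing.Theory Num.Theory.
Import numFieldNormedType.Exports.

Local Open Scope classical_set_scope.
Local Open Scope ring_scope.

Section LocallyConvex.
Context {R : realType} {X : normedModType R}.
Implicit Types S B : set X.

Definition algebraic_core S : set X :=
  [set s | S s /\ forall v : X, exists2 rho : R, 0 < rho &
     forall l : R, 0 <= l <= rho -> S (s + l *: v)].

Definition balanced B : Prop :=
  forall (a : R) (x : X), `|a| <= 1 -> B x -> B (a *: x).

Definition absorbing B : Prop :=
  forall x : X, exists2 rho : R, 0 < rho &
    forall a : R, `|a| <= rho -> B (a *: x).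

Definition barrel B : Prop :=
  [/\ closed B, convex_set (B : set (convex_lmodType X)),
      balanced B & absorbing B].

End LocallyConvex.

Definition barrelled (R : realType) (X : normedModType R) : Prop :=
  forall B : set X, barrel B -> nbhs (0 : X) B.

Section Dual.
Context {R : realType}.

Record topological_dual (X : normedModType R) := Dual {
  dual_fun :> {linear X -> R^o} ;
  dual_continuous : continuous dual_fun }.

HB.instance Definition _ (X : normedModType R) :=
  gen_eqMixin (topological_dual X).
HB.instance Definition _ (X : normedModType R) :=
  gen_choiceMixin (topological_dual X).

Definition pairing (X : normedModType R) (x : X) (f : topological_dual X) : R :=
  f x.

Definition dual_norm (X : normedModType R) (f : topological_dual X) : R :=
  sup [set `|pairing x f| | x in [set x : X | `|x| <= 1]].

Definition weak_star (X : normedModType R) : topologicalType :=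
  initial_topology
    (fun f : topological_dual X => (fun x => pairing x f) : {ptws X -> R}).

End Dual.

Section Nets.
Context {I : Type}.
Implicit Type le : I -> I -> Prop.

Definition directed_preorder le : Prop :=
  [/\ inhabited I, forall i, le i i,
      forall i j k, le i j -> le j k -> le i k &
      forall i j, exists k, le i k /\ le j k].

(* A net u : I -> Y converges to y when u @ net_tails le --> y. *)
Definition net_tails le : set_system I :=
  [set A | exists i0, forall i, le i0 i -> A i].

End Nets.

Section Multifunctions.
Context {R : realType} {X : normedModType R}.
Implicit Type T : X -> set (topological_dual X).

Definition mf_domain T : set X := [set x | T x !=set0].

(* <x1 - x2, f1 - f2> is expanded by linearity in the second argument. *)
Definition monotone_operator T : Prop :=
  forall (x1 x2 : X) (f1 f2 : topological_dual X), T x1 f1 -> T x2 f2 ->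
    0 <= pairing (x1 - x2) f1 - pairing (x1 - x2) f2.

Definition demiclosed T : Prop :=
  forall (I : Type) (le : I -> I -> Prop) (x : I -> X)
    (f : I -> topological_dual X) (x0 : X) (f0 : topological_dual X),
    directed_preorder le ->
    (forall i, T (x i) (f i)) ->
    x @ net_tails le --> x0 ->
    (f : I -> weak_star X) @ net_tails le --> (f0 : weak_star X) ->
    (exists M : R, forall i, dual_norm (f i) <= M) ->
    T x0 f0.

Definition strong_weak_star_usc_at T (x : X) : Prop :=
  forall V : set (weak_star X), open V -> T x `<=` V ->
    exists2 U : set X, nbhs x U & \bigcup_(u in U) T u `<=` V.

End Multifunctions.

(* Main.v *)
(** Local boundedness at [x] comes from barrelledness alone: the set of all
    [y] such that [<x - u, f> + |<y, f>| <= k] for every [(u, f)] in the graph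
    of [T] with [|u - x| <= 1] is closed, convex and balanced, and monotonicity
    compared with points of [T] above [x], [x + rho v] and [x - rho v] makes it
    absorbing for a suitable [k]. If upper semicontinuity failed for [V], an
    ultrafilter on the graph would converge to [x] in the first component and
    avoid [V] in the second; by local boundedness and Banach-Alaoglu its second
    component converges weakly-star, and demiclosedness puts the limit in
    [T x], hence in [V]. *)
Require Import Defs.
From HB Require Import structures.
From mathcomp Require Import all_boot all_order all_algebra.
From mathcomp Require Import all_classical all_reals all_analysis.
From mathcomp Require Import lra.

Set Implicit Arguments.
Unset Strict Implicit.
Unset Printing Implicit Defensive.

Import Order.TTheory GRing.Theory Num.Theory.
Import numFieldNormedType.Exports.

Local Open Scope classical_set_scope.
Local Open Scope ring_scope.

Lemma ultra_fmap (Y Z : Type) (h : Y -> Z) (F : set_system Y) :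
  UltraFilter F -> UltraFilter (h @ F).
Proof.
move=> FU; split; first exact: fmap_proper_filter.
move=> G GP hFG; rewrite predeqE => A; split=> [GA|/hFG //].
have [//|nA] := in_ultra_setVsetC (h @^-1` A) FU.
have /hFG GnA : (h @ F) (~` A) by [].
by have [z []] := @filter_ex _ G _ _ (filterI GA GnA).
Qed.

(* The net indexed by the pointed members [(A, y)], [y \in A], of the filter. *)
Lemma filter_net (Y : Type) (G : set_system Y) (D : set Y) :
  ProperFilter G -> G D ->
  exists (I : Type) (le : I -> I -> Prop) (p : I -> Y),
    [/\ directed_preorder le, forall i, D (p i) &
        forall A, G A -> net_tails le (p @^-1` A)].
Proof.
move=> GP GD.
exists {q : set Y * Y | [/\ G q.1, q.1 `<=` D & q.1 q.2]},
  (* Smaller sets come later, whatever their marked points. *)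
  (fun i j => (sval j).1 `<=` (sval i).1), (fun i => (sval i).2).
split.
- split.
  + have [y Dy] := @filter_ex _ G _ _ GD.
    by constructor; exists (D, y); split.
  + by move=> i.
  + by move=> i j k ij jk; exact: subset_trans ij.
  + move=> [[A a] [/= GA AD _]] [[B b] [/= GB _ _]].
    have GAB : G (A `&` B) by exact: filterI.
    have [y ABy] := @filter_ex _ G _ _ GAB.
    have P : [/\ G (A `&` B), A `&` B `<=` D & (A `&` B) y].
      by split=> // z [/AD].
    by exists (exist _ (A `&` B, y) P); split=> z [].
- by move=> [[A a] [/= _ AD Aa]]; exact: AD.
- move=> A GA; have GAD : G (A `&` D) by exact: filterI.
  have [y ADy] := @filter_ex _ G _ _ GAD.
  have P : [/\ G (A `&` D), A `&` D `<=` D & (A `&` D) y] by split=> // z [].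
  exists (exist _ (A `&` D, y) P) => -[[B b] [/= _ _ Bb]] BAD.
  by have [] := BAD _ Bb.
Qed.

Section DualSpace.
Context {R : realType} {X : normedModType R}.
Implicit Types (f : topological_dual X) (T : X -> set (topological_dual X)).

Lemma dual_bounded f : exists2 M : R, 0 <= M & forall z, `|f z| <= M * `|z|.
Proof.
have /linear_bounded_continuous/linear_boundedP := @dual_continuous _ _ f.
by move=> /pinfty_ex_gt0[M M0 fM]; exists M; first exact: ltW.
Qed.

(** No sign is assumed on [M], hence [|M|]: the local bound used later comes without a sign. *)
Lemma dual_norm_le f (M : R) :
  (forall z, `|f z| <= M * `|z|) -> dual_norm f <= `|M|.
Proof.
move=> fM; apply: ge_sup; first by exists `|pairing 0 f|, 0; rewrite //= normr0.
move=> _ [z /= z1 <-]; rewrite (le_trans (fM z))//.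
by rewrite (le_trans (ler_wpM2r _ (ler_norm M)))// ler_piMr.
Qed.

(** By Tychonoff a product of segments is compact, so the ultrafilter converges pointwise; the limit
    is linear and inherits the bound, hence is continuous. *)
Lemma banach_alaoglu (I : Type) (F : set_system I)
    (f : I -> topological_dual X) (M : R) :
  UltraFilter F -> F [set i | forall z, `|f i z| <= M * `|z|] ->
  exists f0 : topological_dual X,
    (f : I -> weak_star X) @ F --> (f0 : weak_star X).
Proof.
move=> FU FM.
pose ev (g : topological_dual X) : {ptws X -> R} := fun z => pairing z g.
pose K := [set g : {ptws X -> R} | forall z, `[- (M * `|z|), M * `|z|]%classic (g z)].
have cK : compact K.
  exact (@tychonoff X (fun=> R : topologicalType)
    (fun z => `[- (M * `|z|), M * `|z|]%classic) (fun=> @segment_compact R _ _)).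
have FK : F ((fun i => ev (f i)) @^-1` K).
  apply: filterS FM => i fiM z; rewrite /= in_itv /= -ler_norml.
  exact: fiM.
move: cK; rewrite compact_ultra => /(_ _ (ultra_fmap (fun i => ev (f i)) FU) FK)[g [Kg cg]].
have cgz z : (fun i => f i z : R) @ F --> g z.
  have := (@pointwise_cvgP X R _ g (fmap_filter _ _)).1 cg z.
  exact.
have glin : linear (g : X -> R^o).
  move=> a u v.
  have fE : (fun i => f i (a *: u + v) : R) = (fun i => a * (f i u : R) + (f i v : R)).
    by apply/funext => i; rewrite linearP.
  apply: (@cvg_unique R _ ((fun i => f i (a *: u + v) : R) @ F)) => //; first exact: cgz.
  rewrite fE; apply: (@cvgD _ R^o) => //.
  by apply: cvgM; [exact: cvg_cst|exact: cgz].
pose gL := GRing.isLinear.Build R X R^o _ (g : X -> R^o) glin.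
pose g1 : {linear X -> R^o} := HB.pack (g : X -> R^o) gL.
have g1c : continuous g1.
  apply/linear_bounded_continuous/linear_boundedP.
  near=> r => z; have := Kg z; rewrite /= in_itv /= -ler_norml => /le_trans; apply.
  by rewrite ler_wpM2r//; near: r; apply: nbhs_pinfty_ge; rewrite num_real.
(* A weak-star open set is the preimage under [ev] of a set [B] open for pointwise convergence. *)
exists (Dual g1c) => A [_ [[B oB <-] /= Bg BA]].
have FB : F ((fun i => ev (f i)) @^-1` B) by apply: cg; exact: open_nbhs_nbhs.
change (F (f @^-1` A)); apply: filterS FB => i; exact: BA.
Unshelve. all: by end_near. Qed.

(** Monotonicity against a fixed [f0] in [T x] gives [f (x - u) <= f0 (x - u)]; [C] is a bound for
    [f0], so it depends neither on [(u, f)] nor on [y]. *)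
Lemma monotone_pairing_le T (x : X) :
  monotone_operator T -> mf_domain T x ->
  exists2 C : R, 0 <= C & forall u f, T u f -> forall y,
    `|u - y| <= 1 -> f (x - u) <= C * (`|x - y| + 1).
Proof.
move=> Tmono [f0 Tf0]; have [C C0 f0C] := dual_bounded f0.
exists C => // u f Tuf y uy.
have := Tmono _ _ _ _ Tf0 Tuf; rewrite /pairing subr_ge0 => /le_trans; apply.
rewrite (le_trans (ler_norm _))// (le_trans (f0C _))// ler_wpM2l//.
by rewrite -(subrKA y) (le_trans (ler_normD _ _))// lerD2l distrC.
Qed.

(** Without [f (x - u)] this would be a scaled polar of the values of [T] near [x]; the term is kept
    because monotonicity only controls [f (x - u)] plus or minus [r * f v]. *)
Definition local_polar T (x : X) (k : R) : set X :=
  [set y | forall u f, T u f -> `|u - x| <= 1 -> f (x - u) + `|f y| <= k].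

Lemma local_polar_absorbing T (x : X) :
  monotone_operator T -> algebraic_core (mf_domain T) x ->
  exists k : R, absorbing (local_polar T x k).
Proof.
move=> Tmono [Tx corex].
have [C0 C0_ge0 TC0] := monotone_pairing_le Tmono Tx.
(* [k] must not depend on [v]: [C0] pays for the weight [1 - D^-1], and [1] for [D^-1] times the
   bound [D], which does depend on [v]. *)
exists (C0 + 1) => v.
have [r1 r1_gt0 Tr1] := corex v; have [r2 r2_gt0 Tr2] := corex (- v).
pose r := Num.min r1 r2.
have r_gt0 : 0 < r by rewrite lt_min r1_gt0.
have /(monotone_pairing_le Tmono)[C1 C1_ge0 TC1] : mf_domain T (x + r *: v).
  by apply: Tr1; rewrite ltW//= ge_min lexx.
have /(monotone_pairing_le Tmono)[C2 C2_ge0 TC2] : mf_domain T (x + r *: - v).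
  by apply: Tr2; rewrite ltW//= ge_min lexx orbT.
(* [C1 * c] and [C2 * c] are the bounds at [x + r *: v] and [x - r *: v]; the last [1] gives
   [D^-1 <= 1]. *)
pose c := r * `|v| + 1; pose D := C1 * c + C2 * c + 1.
have c_ge0 : 0 <= c by rewrite addr_ge0// mulr_ge0// ltW.
have D_gt0 : 0 < D by rewrite ltr_wpDl// addr_ge0// mulr_ge0.
have D_ge1 : 1 <= D by rewrite lerDr addr_ge0// mulr_ge0.
exists (r / D) => [|a a_le u f Tuf ux]; first exact: divr_gt0.
have f0 : f (x - u) <= C0 by have := TC0 _ _ Tuf _ ux; rewrite subrr normr0 add0r mulr1.
have f1 : f (x - u) + r * f v <= D.
  have := TC1 _ _ Tuf _ ux.
  rewrite -addrA [r *: v - u]addrC addrA linearD linearZ/=.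
  rewrite [x + _]addrC addrK normrZ gtr0_norm// -/c => /le_trans; apply.
  by rewrite /D -addrA lerDl addr_ge0// mulr_ge0.
have f2 : f (x - u) - r * f v <= D.
  have := TC2 _ _ Tuf _ ux.
  rewrite -addrA [r *: - v - u]addrC addrA linearD linearZ/= linearN/=.
  rewrite [x + _]addrC addrK normrZ normrN gtr0_norm// -/c.
  rewrite /GRing.scale/= mulrN => /le_trans; apply.
  by rewrite /D -addrA [leRHS]addrCA lerDl addr_ge0// mulr_ge0.
have fr : f (x - u) + r * `|f v| <= D by case: (ler0P (f v)) => _; rewrite ?mulrN.
rewrite linearZ normrZ/=.
have s_ge0 : 0 <= D^-1 by rewrite invr_ge0 ltW.
have s_le1 : D^-1 <= 1 by rewrite invf_le1.
have {}a_le : `|a| * `|f v| <= D^-1 * (r * `|f v|).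
  by rewrite mulrA [D^-1 * r]mulrC ler_wpM2r.
have fD : D^-1 * (f (x - u) + r * `|f v|) <= 1.
  by rewrite mulrC ler_pdivrMr// mul1r.
(* [f (x - u)] is split as the convex combination of itself with weight [D^-1]. *)
have fC : (1 - D^-1) * f (x - u) <= C0.
  rewrite (le_trans (ler_wpM2l _ f0)) ?subr_ge0//.
  by rewrite ler_piMl// lerBlDr lerDl.
nra.
Qed.

Lemma local_polar_closed T (x : X) (k : R) : closed (local_polar T x k).
Proof.
have -> : local_polar T x k = \bigcap_(p in [set p : X * topological_dual X |
    T p.1 p.2 /\ `|p.1 - x| <= 1])
    [set y | (p.2 (x - p.1) : R) + `|p.2 y| <= k].
  apply/seteqP; split=> y /= Py => [[u f] /= [Tuf ux]|u f Tuf ux].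
    exact: Py.
  exact: (Py (u, f)).
apply: closed_bigI => -[u f] _ /=.
apply: (@preimage_closed _ _ (fun y => (f (x - u) : R) + `|f y|) [set t | t <= k]).
  by move=> y _; apply: cvgD; [exact: cvg_cst|apply: cvg_norm; exact: dual_continuous].
exact: closed_le.
Qed.

Lemma local_polar_barrel T (x : X) (k : R) :
  absorbing (local_polar T x k) -> barrel (local_polar T x k).
Proof.
move=> abs; split => //.
- exact: local_polar_closed.
- move=> y z l /set_mem Py /set_mem Pz; apply/mem_set => u f Tuf ux.
  have {Py} fy := Py _ _ Tuf ux; have {Pz} fz := Pz _ _ Tuf ux.
  have l0 : 0 <= l%:num by [].
  have l1 : 0 <= (1 - l%:num) by rewrite subr_ge0.
  rewrite (_ : conv l y z = l%:num *: (y : X) + (1 - l%:num) *: (z : X))//.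
  have : `|f (l%:num *: (y : X) + (1 - l%:num) *: (z : X))| <=
      l%:num * `|f y| + (1 - l%:num) * `|f z|.
    rewrite linearD !linearZ/= (le_trans (ler_normD _ _))//.
    by rewrite !normrM (ger0_norm l0) (ger0_norm l1).
  nra.
- move=> a y a1 Py u f Tuf ux; rewrite linearZ normrZ.
  by rewrite (le_trans _ (Py _ _ Tuf ux))// lerD2l ler_piMl.
Qed.

Lemma monotone_locally_bounded T (x : X) :
  barrelled X -> monotone_operator T -> algebraic_core (mf_domain T) x ->
  exists M : R, \forall u \near x,
    forall f, T u f -> forall z, `|f z| <= M * `|z|.
Proof.
move=> Xb Tmono corex; have [k /local_polar_barrel/Xb] := local_polar_absorbing Tmono corex.
move=> /nbhs_norm0P[r /= r_gt0 Br].
(* Each [f] is bounded by [2 * k] on the open ball of radius [r]; vectors are rescaled to norm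
   [r / 2] to lie inside it. *)
exists (2 * k / (r / 2)); near=> u => f Tuf z.
have ux1 : `|u - x| <= 1 by near: u; exact: cvgr_distC_le.
have uxr : `|u - x| < r / 2.
  by near: u; apply: cvgr_distC_lt => //; rewrite divr_gt0.
have fB y : `|y| < r -> f (x - u) + `|f y| <= k by move=> /Br; apply.
(* Testing with [y = 2 *: (x - u)] gives [f (x - u) + 2 * |f (x - u)| <= k], where the first term is
   at least [- |f (x - u)|]. *)
have fk : `|f (x - u)| <= k.
  have := fB (2 *: (x - u)); rewrite normrZ distrC ger0_norm//.
  rewrite -ltr_pdivlMl// mulrC => /(_ uxr).
  rewrite linearZ normrZ ger0_norm//.
  have := ler_norm (- f (x - u)); rewrite normrN; lra.
have f2k y : `|y| < r -> `|f y| <= 2 * k.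
  move=> /fB; have := ler_norm (- f (x - u)); rewrite normrN; lra.
have [->|z0] := eqVneq z 0; first by rewrite linear0 !normr0 mulr0.
have nz : 0 < `|z| by rewrite normr_gt0.
have c_gt0 : 0 < r / 2 / `|z| by rewrite !divr_gt0.
have := f2k ((r / 2 / `|z|) *: z).
rewrite normrZ (gtr0_norm c_gt0) divfK ?gt_eqF//.
rewrite linearZ normrZ (gtr0_norm c_gt0).
rewrite gtr_pMr// invf_lt1// ltr1n => /(_ isT).
rewrite -ler_pdivlMl// invf_div => /le_trans; apply.
by rewrite mulrC mulrA mulrAC.
Unshelve. all: by end_near. Qed.

End DualSpace.

Theorem theorem39 (R : realType) (X : normedModType R)
    (X_neq0 : exists v : X, v != 0) (X_barrelled : barrelled X)
    (T : X -> set (topological_dual X)) (T_nonempty : mf_domain T !=set0)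
    (T_monotone : monotone_operator T) (T_demiclosed : demiclosed T) :
  forall x : X, algebraic_core (mf_domain T) x -> strong_weak_star_usc_at T x.
Proof.
move=> x corex V oV TxV; apply: contrapT => noU.
have [M Mx] := monotone_locally_bounded X_barrelled T_monotone corex.
(* The counterexamples over [U], nonempty by [noU], form the base of a proper filter. *)
pose E (U : set X) := [set p : X * topological_dual X |
  [/\ U p.1, T p.1 p.2 & ~ V p.2]].
have FP : ProperFilter (filter_from (nbhs x) E).
  apply: filter_from_proper => [|U xU].
    apply: filter_from_filter; first by exists setT; exact: filterT.
    move=> A B xA xB; exists (A `&` B); first exact: filterI.
    by move=> p [[Ap Bp] Tp Vp].
  apply: contrapT => E0; apply: noU; exists U => // f [u Uu Tuf].
  by apply: contrapT => nVf; apply: E0; exists (u, f).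
have [G [GU FG]] := ultraFilterLemma FP.
have GM : G [set p | [/\ T p.1 p.2, ~ V p.2 & forall z, `|p.2 z| <= M * `|z|]].
  apply: FG; exists [set u | forall f, T u f -> forall z, `|f z| <= M * `|z|] => //.
  by move=> [u f] [/= uM Tuf nVf]; split=> //; exact: uM.
have [|f0 cf0] := @banach_alaoglu R X _ G snd M GU.
  by apply: filterS GM => p [].
(* Demiclosedness speaks of nets bounded at every index, so the net is taken inside the set of
   [GM]. *)
have [I [le [p [dir pM pG]]]] := filter_net _ GM.
have Tf0 : T x f0.
  apply: (T_demiclosed I le (fst \o p) (snd \o p)) => //.
  - by move=> i; have [] := pM i.
  - move=> A xA; apply: (pG (fst @^-1` A)); apply: FG.
    by exists A => // q [].
  - by move=> A /cf0; exact: pG.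
  - by exists `|M| => i; apply: dual_norm_le; have [] := pM i.
(* [G] now contains both the pairs with second component in [V] and a set of pairs avoiding [V]. *)
have GV : G (snd @^-1` V) by apply: cf0; apply: open_nbhs_nbhs; split=> //; exact: TxV.
by have [q [Vq []]] := @filter_ex _ G _ _ (filterI GV GM).
Qed.
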